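(* Let $N = 2$, let $K \ge 1$ be arbitrary, let $H \in \mathbb{C}^{K \times 2}$, put $\alpha_{1,2} = [H^H H]_{1,2}$ and assume $\alpha_{1,2} \ne 0$, and let $p_1, p_2 > 0$. Let $\theta_1,\theta_2$ be real numbers with $\theta_1 - \theta_2 = \arg \alpha_{1,2}$. Then $Q = \mathbf{w}\mathbf{w}^H$ with $\mathbf{w} = [\sqrt{p_1}\,e^{j\theta_1},\ \sqrt{p_2}\,e^{j\theta_2}]^T$ is an optimal solution of the problem of maximizing $\operatorname{tr}(HQH^H)$ over Hermitian positive semidefinite $Q \in \mathbb{C}^{2\times 2}$ subject to $q_{1,1} \le p_1$ and $q_{2,2} \le p_2$.
   Context: $(\cdot)^H$ denotes the conjugate transpose, $(\cdot)^T$ the transpose, $q_{i,j}$ is the $(i,j)$ entry of $Q$, and in exponentials $j$ denotes the imaginary unit. $\arg z$ denotes an argument (phase) of the nonzero complex number $z$. *)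

(* Defs.v *)
From mathcomp Require Import all_boot all_order all_algebra.
From mathcomp Require Import complex.
From mathcomp Require Import all_classical all_reals all_analysis.

Set Implicit Arguments.
Unset Strict Implicit.
Unset Printing Implicit Defensive.

Import Order.TTheory GRing.Theory Num.Theory.

Local Open Scope ring_scope.
Local Open Scope complex_scope.
Local Open Scope sesquilinear_scope.

(* MathComp-Analysis has no complex exponential: e^{jt} is given by Euler's
   formula. *)
Definition expi (R : realType) (t : R) : R[i] := cos t +i* sin t.

(* [t] is an argument of [z], not necessarily the principal one; meaningful for
   [z != 0] only (every [t] satisfies it when [z = 0]). *)
Definition is_arg (R : realType) (t : R) (z : R[i]) : Prop :=
  z = `|z| * expi t.

(* The order on [R[i]] is the partial one: [u <= v] holds iff [u] and [v] have
   the same imaginary part and [Re u <= Re v]; in particular [0 <= u] entails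
   that [u] is real. *)
Definition psdmx (R : realType) (n : nat) (Q : 'M[R[i]]_n) : Prop :=
  Q \is hermsymmx /\ forall x : 'cV[R[i]]_n, 0 <= (x^t* *m Q *m x) 0 0.

Definition feasible (R : realType) (p1 p2 : R) (Q : 'M[R[i]]_2) : Prop :=
  [/\ psdmx Q, Q 0 0 <= p1%:C & Q 1 1 <= p2%:C].

Definition objective (R : realType) (K : nat) (H : 'M[R[i]]_(K, 2))
    (Q : 'M[R[i]]_2) : R[i] :=
  \tr (H *m Q *m H^t*).

Definition optimal (R : realType) (K : nat) (H : 'M[R[i]]_(K, 2)) (p1 p2 : R)
    (Q : 'M[R[i]]_2) : Prop :=
  feasible p1 p2 Q /\
  forall Q' : 'M[R[i]]_2,
    feasible p1 p2 Q' -> objective H Q' <= objective H Q.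

Definition beam (R : realType) (p1 p2 theta1 theta2 : R) : 'cV[R[i]]_2 :=
  \col_(i < 2) (if i == 0 then (Num.sqrt p1)%:C * expi theta1
                else (Num.sqrt p2)%:C * expi theta2).

(* Main.v *)
(* With A = H^H H and A 0 1 = |A 0 1| u, the objective is
     A 0 0 * Q 0 0 + A 1 1 * Q 1 1 + |A 0 1| X,  X = u * Q 1 0 + u^* * Q 0 1,
   with nonnegative coefficients. Positivity of Q on one well-chosen vector
   bounds X by 2 sqrt (p1 p2), and w w^H attains all three bounds at once. *)
Require Import Defs.
From mathcomp Require Import all_boot all_order all_algebra.
From mathcomp Require Import complex ring.
From mathcomp Require Import all_classical all_reals all_analysis.

Import Order.TTheory GRing.Theory Num.Theory.

Local Open Scope ring_scope.
Local Open Scope complex_scope.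
Local Open Scope sesquilinear_scope.

Lemma big_ord2 (V : nmodType) (F : 'I_2 -> V) : \sum_i F i = F 0 + F 1.
Proof. by rewrite !big_ord_recl big_ord0 addr0; congr (_ + F _); apply: val_inj. Qed.

Lemma expiB (R : realType) (s t : R) : expi (s - t) = expi s * (expi t)^*%R.
Proof.
(* The generic conjugation is replaced by the convertible one specific to [R[i]], on which [simpc]
   computes. *)
rewrite -[(expi t)^*%R]/((expi t)^*) /expi cosB sinB; simpc.
by congr (_ +i* _); rewrite addrC.
Qed.

Lemma mulr_conj_expi (R : realType) (t : R) : expi t * (expi t)^*%R = 1.
Proof. by rewrite -expiB subrr /expi cos0 sin0. Qed.

Lemma quad_form2 (C : numClosedFieldType) (Q : 'M[C]_2) (x : 'cV[C]_2) :
  (x^t* *m Q *m x) 0 0 =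
  x 0 0 * (x 0 0)^*%R * Q 0 0 + x 1 0 * (x 1 0)^*%R * Q 1 1
  + (x 0 0 * (x 1 0)^*%R * Q 1 0 + (x 0 0)^*%R * x 1 0 * Q 0 1).
Proof. rewrite !mxE !big_ord2 !mxE !big_ord2 !mxE; ring. Qed.

Lemma gram_conj (C : numClosedFieldType) m n (H : 'M[C]_(m, n)) :
  (H^t* *m H)^t* = H^t* *m H.
Proof. by rewrite trmx_mul map_mxM /= trmxCK. Qed.

(** The entry is the squared norm of column [i] of [H]. *)
Lemma gram_diag_ge0 (C : numClosedFieldType) m n (H : 'M[C]_(m, n)) i :
  0 <= (H^t* *m H) i i.
Proof.
by rewrite !mxE; apply: sumr_ge0 => k _; rewrite !mxE mulrC mul_conjC_ge0.
Qed.

Lemma psdmx_outer (R : realType) n (w : 'cV[R[i]]_n) : psdmx (w *m w^t*).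
Proof.
split.
  by apply/is_hermitianmxP; rewrite expr0 scale1r trmx_mul map_mxM /= trmxCK.
move=> x; rewrite mulmxA -mulmxA.
(* The form becomes [z] times its conjugate for the scalar [z = x^t* *m w]. *)
have -> : w^t* *m x = (x^t* *m w)^t* by rewrite trmx_mul map_mxM /= trmxCK.
move: (x^t* *m w) => z; rewrite mxE big_ord1 !mxE.
exact: mul_conjC_ge0.
Qed.

Lemma psdmx_cross_le (R : realType) (Q : 'M[R[i]]_2) (s1 s2 e1 e2 : R[i]) :
  psdmx Q -> 0 < s1 -> 0 < s2 -> e1 * e1^*%R = 1 -> e2 * e2^*%R = 1 ->
  Q 0 0 <= s1 ^+ 2 -> Q 1 1 <= s2 ^+ 2 ->
  e1 * e2^*%R * Q 1 0 + e1^*%R * e2 * Q 0 1 <= s1 * s2 *+ 2.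
Proof.
move=> [_ Qpsd] s1_gt0 s2_gt0 e1K e2K Q00 Q11.
have s1K : s1^*%R = s1 by apply/conj_Creal/gtr0_real.
have s2K : s2^*%R = s2 by apply/conj_Creal/gtr0_real.
set X := _ + _ * Q 0 1.
(* This vector is orthogonal to (s1 e1, s2 e2), the optimal beam. *)
have := Qpsd (\col_i (if i == 0 then s2 * e1 else - (s1 * e2))).
rewrite quad_form2 !mxE /= rmorphN !rmorphM /= s1K s2K.
set Y := (X in _ <= X -> _).
have -> : Y = s2 ^+ 2 * Q 0 0 + s1 ^+ 2 * Q 1 1 - s1 * s2 * X.
  (* Unit factors are reintroduced as [e1 * e1^*] and [e2 * e2^*], making both sides equal as
     polynomials. *)
  rewrite -[s2 ^+ 2]mulr1 -[s1 ^+ 2]mulr1 -{1}e1K -{1}e2K /Y /X; ring.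
rewrite subr_ge0 => leX.
rewrite -(ler_pM2l (mulr_gt0 s1_gt0 s2_gt0)); apply: le_trans leX _.
have -> : s1 * s2 * (s1 * s2 *+ 2) = s2 ^+ 2 * s1 ^+ 2 + s1 ^+ 2 * s2 ^+ 2 by ring.
by rewrite lerD// ler_pM2l// exprn_gt0.
Qed.

(** Cyclicity of the trace gives [\tr (A *m Q)] with [A] Hermitian; since [c] is real, conjugating
    [A 0 1] affects only [u]. *)
Lemma objectiveE (R : realType) K (H : 'M[R[i]]_(K, 2)) (Q : 'M[R[i]]_2)
    (c u : R[i]) :
  0 <= c -> (H^t* *m H) 0 1 = c * u ->
  objective H Q = (H^t* *m H) 0 0 * Q 0 0 + (H^t* *m H) 1 1 * Q 1 1
                  + c * (u * Q 1 0 + u^*%R * Q 0 1).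
Proof.
move=> c_ge0 a01.
have a10 : (H^t* *m H) 1 0 = c * u^*%R.
  rewrite -gram_conj mxE mxE a01 rmorphM /=; congr (_ * _).
  exact/conj_Creal/ger0_real.
rewrite /objective mxtrace_mulC mulmxA.
move: (H^t* *m H) a01 a10 => A a01 a10.
rewrite /mxtrace big_ord2 !mxE !big_ord2 a01 a10; ring.
Qed.

Theorem mainTheorem3 (R : realType) (K : nat) (hK : (1 <= K)%N)
    (H : 'M[R[i]]_(K, 2)) (halpha : (H^t* *m H) 0 1 != 0)
    (p1 p2 : R) (hp1 : 0 < p1) (hp2 : 0 < p2)
    (theta1 theta2 : R)
    (htheta : is_arg (theta1 - theta2) ((H^t* *m H) 0 1)) :
  optimal H p1 p2
    (beam p1 p2 theta1 theta2 *m (beam p1 p2 theta1 theta2)^t*).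
Proof.
set w := beam _ _ _ _; set Q := w *m _.
set s1 : R[i] := (Num.sqrt p1)%:C; set s2 : R[i] := (Num.sqrt p2)%:C.
set e1 := expi theta1; set e2 := expi theta2.
have s1_gt0 : 0 < s1 by rewrite ltcR sqrtr_gt0.
have s2_gt0 : 0 < s2 by rewrite ltcR sqrtr_gt0.
have s1K : s1^*%R = s1 by apply/conj_Creal/gtr0_real.
have s2K : s2^*%R = s2 by apply/conj_Creal/gtr0_real.
have p1E : p1%:C = s1 ^+ 2 by rewrite -rmorphXn /= sqr_sqrtr// ltW.
have p2E : p2%:C = s2 ^+ 2 by rewrite -rmorphXn /= sqr_sqrtr// ltW.
have e1K : e1 * e1^*%R = 1 by exact: mulr_conj_expi.
have e2K : e2 * e2^*%R = 1 by exact: mulr_conj_expi.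
have w0 : w 0 0 = s1 * e1 by rewrite mxE.
have w1 : w 1 0 = s2 * e2 by rewrite mxE.
have QE i j : Q i j = w i 0 * (w j 0)^*%R by rewrite mxE big_ord1 !mxE.
have Q00 : Q 0 0 = s1 ^+ 2.
  by rewrite QE w0 rmorphM /= s1K mulrACA e1K mulr1.
have Q11 : Q 1 1 = s2 ^+ 2.
  by rewrite QE w1 rmorphM /= s2K mulrACA e2K mulr1.
split; first by split; [exact: psdmx_outer | rewrite Q00 p1E | rewrite Q11 p2E].
move=> Q' [Q'psd Q'00 Q'11]; rewrite p1E in Q'00; rewrite p2E in Q'11.
(* The phase [u] of the off-diagonal Gram entry is thus [e1 * e2^*]. *)
have := htheta; rewrite /is_arg expiB => a01.
(* The phases of the beam cancel [u], so each of the two terms equals [s1 * s2]. *)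
have cross : e1 * e2^*%R * Q 1 0 + (e1 * e2^*%R)^*%R * Q 0 1 = s1 * s2 *+ 2.
  rewrite !QE w0 w1 !rmorphM /= conjCK s1K s2K.
  have -> : s1 * s2 *+ 2 = s1 * s2 * ((e1 * e1^*%R) * (e2 * e2^*%R)) *+ 2.
    by rewrite e1K e2K !mulr1.
  ring.
rewrite !(objectiveE _ _ _ _ _ _ (normr_ge0 _) a01) cross Q00 Q11.
(* Termwise comparison: the power constraints settle the diagonal terms, leaving the cross term. *)
rewrite !lerD// ler_wpM2l ?gram_diag_ge0//.
rewrite rmorphM /= conjCK.
exact: psdmx_cross_le.
Qed.
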